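(* Let $m\geq 1$ and $n\geq 1$ be integers, let $p_-,q_-,p_+,q_+$ be real parameters with $-1<p_\pm\leq q_\pm<1$, and put $a_\pm=p_\pm q_\pm$, $b_\pm=p_\pm+q_\pm$. Then for all $\hat\lambda,\hat\mu\in\Lambda^{(m,n)}$ one has (with the notation of the context) $$\sum_{\lambda\in\Lambda^{(m,n)}}\psi^{(m,n)}_{\hat\lambda}(\lambda)\,\psi^{(m,n)}_{\hat\mu}(\lambda)\,\Delta^{(m,n)}_\lambda=\begin{cases}0&\text{if }\hat\mu\neq\hat\lambda,\\ 1/\hat\Delta^{(m,n)}_{\hat\lambda}&\text{if }\hat\mu=\hat\lambda,\end{cases}$$ where $$\hat\Delta^{(m,n)}_{\hat\lambda}:=\frac{1}{C\bigl(\boldsymbol{\xi}^{(m,n)}_{\hat\lambda}\bigr)\,C\bigl(-\boldsymbol{\xi}^{(m,n)}_{\hat\lambda}\bigr)\,H^{(m,n)}\bigl(\boldsymbol{\xi}^{(m,n)}_{\hat\lambda}\bigr)},\qquad H^{(m,n)}(\boldsymbol{\xi}):=\prod_{1\leq j\leq n}H^{(m+n-1)}(\xi_j).$$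
   Context: Notation. $\delta_l:=1$ if $l=0$ and $\delta_l:=0$ for every nonzero integer $l$. For $-1<q<1$ and $\xi\in\mathbb{R}$, $$v_q(\xi):=\int_0^\xi\frac{1-q^2}{1-2q\cos(x)+q^2}\,dx .$$ For an integer $M\geq 1$ and $\hat l\in\{0,1,\ldots,M\}$, $\xi^{(M)}_{\hat l}$ denotes the unique real solution $\xi$ of $$2M\xi+v_{p_-}(\xi)+v_{q_-}(\xi)+v_{p_+}(\xi)+v_{q_+}(\xi)=2\pi(\hat l+1);$$ one has $0<\xi^{(M)}_0<\xi^{(M)}_1<\cdots<\xi^{(M)}_M<\pi$. Also $$H^{(M)}(\xi):=2M+v'_{p_-}(\xi)+v'_{q_-}(\xi)+v'_{p_+}(\xi)+v'_{q_+}(\xi),$$ the prime denoting the derivative. The two-parameter Bernstein-Szegő polynomials $p_l(\xi)$ ($l\in\mathbb{Z}$) are $$p_l(\xi):=c(\xi)e^{il\xi}+c(-\xi)e^{-il\xi}=U_l(\cos\xi)-b_-U_{l-1}(\cos\xi)+a_-U_{l-2}(\cos\xi),\qquad c(\xi):=\frac{(1-p_-e^{-i\xi})(1-q_-e^{-i\xi})}{1-e^{-2i\xi}},$$ where $U_l(\cos\xi):=\sin((l+1)\xi)/\sin(\xi)$ for $l\in\mathbb{Z}$. (The polynomials $p_l(\xi)$ are not to be confused with the parameters $p_\pm$.) For $\lambda=(\lambda_1,\ldots,\lambda_n)\in\mathbb{Z}^n$ with $\lambda_1\geq\cdots\geq\lambda_n\geq 0$, the generalized Schur polynomial in $\boldsymbol{\xi}=(\xi_1,\ldots,\xi_n)$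 is $$P_\lambda(\boldsymbol{\xi}):=\frac{1}{V(\boldsymbol{\xi})}\det\bigl[p_{n-j+\lambda_j}(\xi_k)\bigr]_{1\leq j,k\leq n},\qquad V(\boldsymbol{\xi}):=\prod_{1\leq j<k\leq n}2\bigl(\cos(\xi_j)-\cos(\xi_k)\bigr).$$ Furthermore $$C(\boldsymbol{\xi}):=\prod_{1\leq j\leq n}\frac{(1-p_-e^{-i\xi_j})(1-q_-e^{-i\xi_j})}{1-e^{-2i\xi_j}}\prod_{1\leq j<k\leq n}(1-e^{-i(\xi_j+\xi_k)})^{-1}(1-e^{-i(\xi_j-\xi_k)})^{-1}.$$ The index set is $$\Lambda^{(m,n)}:=\{\lambda=(\lambda_1,\ldots,\lambda_n)\in\mathbb{Z}^n\mid m\geq\lambda_1\geq\lambda_2\geq\cdots\geq\lambda_n\geq 0\}.$$ For $\hat\lambda\in\Lambda^{(m,n)}$ put $$\boldsymbol{\xi}^{(m,n)}_{\hat\lambda}:=\bigl(\xi^{(m+n-1)}_{\hat\lambda_1+n-1},\xi^{(m+n-1)}_{\hat\lambda_2+n-2},\ldots,\xi^{(m+n-1)}_{\hat\lambda_{n-1}+1},\xi^{(m+n-1)}_{\hat\lambda_n}\bigr),$$ and define $\psi^{(m,n)}_{\hat\lambda}:\Lambda^{(m,n)}\to\mathbb{C}$ by $\psi^{(m,n)}_{\hat\lambda}(\lambda):=P_\lambda\bigl(\boldsymbol{\xi}^{(m,n)}_{\hat\lambda}\bigr)$. The weights are $\Delta^{(m,n)}_\lambda:=(1-a_-\delta_{\lambda_n})^{-1}(1-a_+\delta_{m-\lambda_1})^{-1}$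 for $\lambda\in\Lambda^{(m,n)}$. *)

(* Defs.v *)
From mathcomp Require Import all_boot all_order all_algebra complex ring.
From mathcomp Require Import all_classical all_reals all_analysis.
Import Order.TTheory GRing.Theory Num.Theory numFieldNormedType.Exports.

Set Implicit Arguments.
Unset Strict Implicit.
Unset Printing Implicit Defensive.

Local Open Scope classical_set_scope.
Local Open Scope ring_scope.
Local Open Scope complex_scope.

(* The set of weakly decreasing tuples m >= lam_1 >= ... >= lam_n >= 0. Tuples
   are indexed from 0, so that lam_j is [tnth lam (j - 1)]. *)
Definition Lambda (m n : nat) : {set n.-tuple 'I_m.+1} :=
  [set lam : n.-tuple 'I_m.+1 | sorted geq [seq val x | x <- lam]]%SET.

Section Definitions.
Variable R : realType.

Definition delta (l : int) : R := (l == 0)%:R.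

Definition expi (x : R) : R[i] := cos x +i* sin x.

(* U_l evaluated at cos xi. *)
Definition U (l : int) (xi : R) : R := sin ((l + 1)%:~R * xi) / sin xi.

(* The oriented integral from 0 to xi, hence the case split. *)
Definition v (q xi : R) : R :=
  let f x := (1 - q ^+ 2) / (1 - 2 * q * cos x + q ^+ 2) in
  if 0 <= xi then \int[lebesgue_measure]_(x in `[0, xi]) f x
  else - \int[lebesgue_measure]_(x in `[xi, 0]) f x.

Definition cfun (pm qm xi : R) : R[i] :=
  (1 - pm%:C * expi (- xi)) * (1 - qm%:C * expi (- xi)) / (1 - expi (- 2 * xi)).

Definition bernstein_szego (pm qm : R) (l : int) (xi : R) : R[i] :=
  cfun pm qm xi * expi (l%:~R * xi) + cfun pm qm (- xi) * expi (- l%:~R * xi).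

Section Spectrum.
Variables pm qm pp qp : R.

(* Definite description: for 0 <= l <= M and parameters in ]-1, 1[, this is the
   unique real solution of the equation (0 would be a junk value if there were
   none). *)
Definition node (M l : nat) : R :=
  xget 0 [set xi : R | 2 * M%:R * xi + v pm xi + v qm xi + v pp xi + v qp xi
                       = 2 * pi * l.+1%:R].

Definition H1 (M : nat) (xi : R) : R :=
  2 * M%:R + derive1 (v pm) xi + derive1 (v qm) xi
    + derive1 (v pp) xi + derive1 (v qp) xi.

Definition H (m n : nat) (xi : 'rV[R]_n) : R :=
  \prod_(j < n) H1 (m + n - 1)%N (xi 0 j).

Definition nodes (m n : nat) (lamh : n.-tuple 'I_m.+1) : 'rV[R]_n :=
  \row_(j < n) node (m + n - 1)%N (tnth lamh j + (n - j.+1))%N.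

Definition V (n : nat) (xi : 'rV[R]_n) : R :=
  \prod_(j < n) \prod_(k < n | (j < k)%N) (2 * (cos (xi 0 j) - cos (xi 0 k))).

Definition gschur (m n : nat) (lam : n.-tuple 'I_m.+1) (xi : 'rV[R]_n) : R[i] :=
  (V xi)%:C^-1 *
  \det (\matrix_(j < n, k < n)
          bernstein_szego pm qm (n - j.+1 + tnth lam j)%N%:Z (xi 0 k)).

Definition C (n : nat) (xi : 'rV[R]_n) : R[i] :=
  (\prod_(j < n) cfun pm qm (xi 0 j)) *
  \prod_(j < n) \prod_(k < n | (j < k)%N)
     ((1 - expi (- (xi 0 j + xi 0 k)))^-1 *
      (1 - expi (- (xi 0 j - xi 0 k)))^-1).

Definition psi (m n : nat) (lamh lam : n.-tuple 'I_m.+1) : R[i] :=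
  gschur lam (nodes lamh).

(* [nth ord0 lam 0] and [nth ord0 lam n.-1] are lam_1 and lam_n for n >= 1. *)
Definition Delta (m n : nat) (lam : n.-tuple 'I_m.+1) : R :=
  (1 - pm * qm * delta (nth ord0 lam n.-1)%:Z)^-1 *
  (1 - pp * qp * delta (m%:Z - (nth ord0 lam 0)%:Z))^-1.

Definition Deltah (m n : nat) (lamh : n.-tuple 'I_m.+1) : R[i] :=
  (C (nodes lamh) * C (- nodes lamh) * (H m (nodes lamh))%:C)^-1.

End Spectrum.

Lemma expiD (x y : R) : expi (x + y) = expi x * expi y.
Proof.
apply/eqP; rewrite eq_complex /= sinD cosD eqxx /=; apply/eqP.
by rewrite addrC.
Qed.

Lemma expiN_mul (x : R) : expi (- x) * expi x = 1.
Proof. by rewrite -expiD addNr /expi cos0 sin0. Qed.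

Lemma expi_neq0 (x : R) : expi x != 0.
Proof.
apply/eqP => e0; have := expiN_mul x; rewrite e0 mulr0 => /eqP.
by rewrite eq_sym oner_eq0.
Qed.

Lemma expiN (x : R) : expi (- x) = (expi x)^-1.
Proof.
by apply: (mulIf (expi_neq0 x)); rewrite expiN_mul mulVf // expi_neq0.
Qed.

Lemma sin_expi (x : R) : 2 * 'i * (sin x)%:C = expi x - (expi x)^-1.
Proof.
rewrite -expiN /expi cosN sinN; apply/eqP; rewrite eq_complex /=.
by apply/andP; split; apply/eqP; ring.
Qed.

Lemma bernstein_szegoE (pm qm : R) (l : int) (xi : R) : sin xi != 0 ->
  bernstein_szego pm qm l xi =
  (U l xi - (pm + qm) * U (l - 1) xi + pm * qm * U (l - 2) xi)%:C.
Proof.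
move=> s0.
have i0 : 2 * 'i != 0 :> R[i].
  by rewrite mulf_neq0 ?pnatr_eq0 // eq_complex /= oner_eq0 andbF.
have e0 := expi_neq0 xi.
have d0 : expi xi - (expi xi)^-1 != 0.
  by rewrite -sin_expi mulf_neq0 // eq_complex /= (negPf s0).
have w0 := expi_neq0 (l%:~R * xi).
have UE k : (U k xi)%:C = (expi (k%:~R * xi) * expi xi
      - (expi (k%:~R * xi) * expi xi)^-1) / (expi xi - (expi xi)^-1).
  have -> : expi (k%:~R * xi) * expi xi = expi ((k + 1)%:~R * xi).
    by rewrite -expiD intrD1 mulrDl mul1r.
  rewrite -!sin_expi /U.
  by rewrite -mulf_div divff // mul1r fmorph_div.
have exp1 : expi ((l - 1)%:~R * xi) = expi (l%:~R * xi) / expi xi.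
  by rewrite intrB mulrBl mul1r expiD expiN.
have exp2 : expi ((l - 2)%:~R * xi) = expi (l%:~R * xi) / expi xi ^+ 2.
  by rewrite intrB mulrBl expiD expiN mulr_natl expr2 -expiD -mulr2n.
have expm2 : expi (- 2 * xi) = (expi xi ^+ 2)^-1.
  by rewrite mulNr expiN mulr_natl expr2 -expiD -mulr2n.
have exp2' : expi (- 2 * - xi) = expi xi ^+ 2.
  by rewrite mulrNN mulr_natl expr2 -expiD -mulr2n.
have toC (x y z : R) : (x - (pm + qm) * y + pm * qm * z)%:C =
    x%:C - (pm%:C + qm%:C) * y%:C + pm%:C * qm%:C * z%:C.
  by rewrite !(rmorphD, rmorphN, rmorphM).
rewrite toC !UE exp1 exp2 /bernstein_szego /cfun.
rewrite expm2 exp2' opprK mulNr !expiN.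
move: (expi xi) (expi (l%:~R * xi)) e0 d0 w0 => z w z0 d0 w0.
have dz : z ^+ 2 - 1 != 0.
  apply: contra d0 => /eqP h; apply/eqP.
  by apply: (mulfI z0); rewrite mulr0 mulrBr divff // -expr2.
field.
by rewrite z0 w0 -expr2 dz -opprB oppr_eq0 dz.
Qed.
End Definitions.

(* Main.v *)
Require Import Defs.
From mathcomp Require Import all_boot all_order all_algebra all_fingroup complex.
From mathcomp Require Import ring lra zify.
From mathcomp Require Import all_classical all_reals all_analysis.
Import Order.TTheory GRing.Theory Num.Theory numFieldNormedType.Exports.

(* The n-variable sum reduces to one variable by the Cauchy-Binet formula: with
   the staircase indices l_j = lam_j + n - j the weight Delta factors over j, so
   the sum is det (sum_l w_l p_l(xi_j) p_l(eta_k)) / (V(xi) V(eta)).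

   In one variable, put z = e^{i xi}. The antiderivative
   v_q(xi) = xi + 2 atan (q sin xi / (1 - q cos xi)) gives
   e^{i v_q(xi)} = (z - q) / (1 - q z), so exponentiating the equation of the
   nodes turns it into a Bethe equation for z. That equation says precisely that
   the wave c(xi) z^l + c(-xi) z^{-l} satisfies the reflecting boundary
   condition at l = M, so that the Christoffel-Darboux sum telescopes to 0 for
   distinct nodes. For equal nodes the sum of squares is a geometric sum, which
   the Bethe equation splits into one boundary term for each end; each of these
   is the sum of two Poisson kernels v'. *)

Set Implicit Arguments.
Unset Strict Implicit.
Unset Printing Implicit Defensive.

Local Open Scope ring_scope.
Local Open Scope complex_scope.

(** * The Cauchy-Binet formula *)

Section CauchyBinet.
Variables n N : nat.

(** Encodes an n-element subset of ['I_N] by its decreasing enumeration. Decreasing order matches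
    the indices lam_j + n - j. *)
Definition decreasing_ffun (g : {ffun 'I_n -> 'I_N}) : bool :=
  [forall i : 'I_n, forall j : 'I_n, (i < j)%N ==> (g j < g i)%N].

Lemma decreasing_ffun_sorted (g : {ffun 'I_n -> 'I_N}) :
  decreasing_ffun g = sorted gtn [seq val (g i) | i <- enum 'I_n].
Proof.
rewrite sorted_map sorted_pairwise; last by move=> y x z /= yx zy; exact: ltn_trans yx.
apply/forallP/idP => [dec|].
  case: n g dec => [|k] g dec; first by rewrite [enum _]size0nil // size_enum_ord.
  apply/(pairwiseP ord0) => i j; rewrite !inE size_enum_ord => ik jk ij /=.
  have /forallP/(_ (Ordinal jk))/implyP/(_ ij) := dec (Ordinal ik).
  by rewrite (nth_ord_enum ord0 (Ordinal ik)) (nth_ord_enum ord0 (Ordinal jk)).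
move=> pw i; apply/forallP => j; apply/implyP => ij.
have /(pairwiseP i)/(_ i j) := pw.
by rewrite !inE size_enum_ord !nth_ord_enum; apply.
Qed.

Lemma decreasing_ffun_inj (g : {ffun 'I_n -> 'I_N}) : decreasing_ffun g -> injective g.
Proof.
move=> /'forall_forallP dec i j gij; apply/val_inj.
by case: (ltngtP i j) => // lt; have := elimT implyP (dec _ _) lt; rewrite gij ltnn.
Qed.

(** Both value lists are duplicate-free of length n, so inclusion of the images is equality, and a
    strictly sorted list is determined by its elements. *)
Lemma decreasing_ffun_eq (g g' : {ffun 'I_n -> 'I_N}) :
  decreasing_ffun g -> decreasing_ffun g' ->
  (forall i, exists j, g i = g' j) -> g = g'.
Proof.
move=> dg dg' sub.
have uniq_vals h : decreasing_ffun h -> uniq [seq val (h i) | i <- enum 'I_n].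
  move=> dh; rewrite map_inj_uniq ?enum_uniq // => i j /val_inj.
  exact: decreasing_ffun_inj.
have : [seq val (g i) | i <- enum 'I_n] = [seq val (g' i) | i <- enum 'I_n].
  apply: (@irr_sorted_eq _ gtn); rewrite -?decreasing_ffun_sorted //.
  - by move=> y x z /= yx zy; exact: ltn_trans yx.
  - by move=> x /=; rewrite ltnn.
  apply: (uniq_min_size (uniq_vals _ dg) _ _).2; last by rewrite !size_map.
  move=> _ /mapP[i _ ->]; have [j /= ->] := sub i.
  by rewrite (map_f (fun i => val (g' i))) // mem_enum.
by move/eq_in_map => gE; apply/ffunP => i; apply/val_inj/gE; rewrite mem_enum.
Qed.

(** Parametrizes the injective maps bijectively by a decreasing map and a permutation of its
    arguments. *)
Definition perm_ffun (gs : {ffun 'I_n -> 'I_N} * 'S_n) : {ffun 'I_n -> 'I_N} :=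
  [ffun i => gs.1 (gs.2 i)].

Lemma perm_ffun_inj :
  {in finset.setX [set g | decreasing_ffun g] [set: 'S_n] &, injective perm_ffun}.
Proof.
move=> [g s] [g' s'] /[!inE] /= /andP[dg _] /andP[dg' _] /ffunP eq_gs.
have gg' : g = g'.
  apply: decreasing_ffun_eq => // i; exists (s' (s^-1 i)%g).
  by have := eq_gs (s^-1 i)%g; rewrite !ffunE permKV.
subst g'; congr (_, _); apply/permP => i; apply: (decreasing_ffun_inj dg).
by have := eq_gs i; rewrite !ffunE.
Qed.

Lemma perm_ffun_image :
  perm_ffun @: finset.setX [set g | decreasing_ffun g] [set: 'S_n]
  = [set f : {ffun _} | injectiveb f].
Proof.
apply/setP => f; apply/imsetP/idP.
  move=> [[g s] /[!inE]/= /andP[dg _] ->].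
  by apply/injectiveP => i j; rewrite !ffunE => /(decreasing_ffun_inj dg)/perm_inj.
move=> /[!inE] /injectiveP injf.
(* Sorting the values of [f] gives the decreasing map; the permutation records where each value
   lands. *)
pose t := [tuple of sort (fun a b : 'I_N => b <= a)%N [tuple f i | i < n]].
have /tuple_permP[s sE] : perm_eq [tuple f i | i < n] t by rewrite perm_sym perm_sort.
have tE i : tnth t (s i) = f i.
  transitivity (tnth [tuple tnth t (s i) | i < n] i); first by rewrite tnth_mktuple.
  by rewrite -(tnth_mktuple f i); congr tnth; apply/val_inj.
exists ([ffun i => tnth t i], s); last by apply/ffunP => i; rewrite !ffunE tE.
rewrite !inE /= andbT decreasing_ffun_sorted.
have -> : [seq val ([ffun i => tnth t i] i) | i <- enum 'I_n] = [seq val x | x <- t].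
  by rewrite -(map_tnth_enum t) -[RHS]map_comp; apply: eq_map => i /=; rewrite ffunE.
rewrite gtn_sorted_uniq_geq map_inj_uniq ?sort_uniq; last exact: val_inj.
rewrite map_inj_uniq ?enum_uniq //= sorted_map.
by apply: sort_sorted => a b; exact: leq_total.
Qed.

Variable R : comNzRingType.

(** Multilinearity in the rows of A B gives a sum over all maps f. A repeated value of f makes two
    rows of B equal and contributes 0; every other f is a decreasing g after a permutation s, and
    the signed sum over s rebuilds the minor of A. *)
Lemma cauchy_binet (A : 'M[R]_(n, N)) (B : 'M[R]_(N, n)) :
  \det (A *m B)
  = \sum_(g : {ffun 'I_n -> 'I_N} | decreasing_ffun g)
      \det (colsub g A) * \det (rowsub g B).
Proof.
transitivity (\sum_(f : {ffun 'I_n -> 'I_N}) (\prod_i A i (f i)) * \det (rowsub f B)).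
  rewrite /determinant.
  under eq_bigr => s _.
    under eq_bigr => i _ do rewrite mxE.
    rewrite bigA_distr_bigA big_distrr /=.
    over.
  rewrite exchange_big /=; apply: eq_bigr => f _.
  rewrite big_distrr /=; apply: eq_bigr => s _.
  rewrite mulrCA big_split /=; congr (_ * (_ * _)).
  by apply: eq_bigr => i _; rewrite mxE.
rewrite (bigID (fun f : {ffun _} => injectiveb f)) /= [X in _ + X]big1 ?addr0; last first.
  move=> f /injectivePn[i [j ij fij]]; rewrite (determinant_alternate ij) ?mulr0 // => k.
  by rewrite !mxE fij.
rewrite (eq_bigl [in [set f : {ffun 'I_n -> 'I_N} | injectiveb f]]) => [|f /[!inE] //].
rewrite -perm_ffun_image big_imset /=; last exact: perm_ffun_inj.
rewrite (eq_bigl (fun gs => decreasing_ffun gs.1 && true)) => [|gs /[!inE] //].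
rewrite -(pair_big decreasing_ffun xpredT (fun g s =>
  (\prod_i A i (perm_ffun (g, s) i)) * \det (rowsub (perm_ffun (g, s)) B))).
apply: eq_bigr => g _; rewrite big_distrl /=.
apply: eq_bigr => s _.
have -> : rowsub (perm_ffun (g, s)) B = row_perm s (rowsub g B).
  by apply/matrixP => i k; rewrite !mxE ffunE.
rewrite row_permE det_mulmx det_perm mulrCA mulrA.
by congr (_ * _ * _); apply: eq_bigr => i _; rewrite mxE ffunE.
Qed.
End CauchyBinet.

(** * Discrete waves with two boundaries *)

Section DiscreteOrthogonality.
Variable K : fieldType.

(** The one-variable weight whose product along a staircase is [Delta]. *)
Definition boundary_weight (a a' : K) (M l : nat) : K :=
  (1 - a * (l == 0%N)%:R)^-1 * (1 - a' * (l == M)%:R)^-1.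

Lemma sum_boundary_weight (a a' : K) (M : nat) (F : nat -> K) : (0 < M)%N ->
  \sum_(l < M.+1) boundary_weight a a' M l * F l =
  (1 - a)^-1 * F 0%N + \sum_(1 <= l < M) F l + (1 - a')^-1 * F M.
Proof.
case: M => // M _; rewrite -(big_mkord xpredT (fun l => _ l * _ l)).
rewrite big_nat_recr //= big_nat_recl //= big_add1 /=; congr (_ + _ + _).
- by rewrite /boundary_weight eqxx mulr1 mulr0 subr0 invr1 mulr1.
- apply: eq_big_nat => l lM.
  by rewrite /boundary_weight !eqSS (ltn_eqF lM) !mulr0 subr0 invr1 !mul1r.
- by rewrite /boundary_weight eqxx mulr0 subr0 invr1 mul1r mulr1.
Qed.

(** P and Q solve the same three-term recurrence with spectral parameters X and Y, so X - Y times
    the partial sum telescopes to a Casoratian (discrete Wronskian), which the condition at M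
    cancels. *)
Lemma christoffel_darboux (a a' b b' X Y : K) (P Q : nat -> K) (M : nat) :
  (0 < M)%N -> 1 - a != 0 -> 1 - a' != 0 ->
  P 0%N = 1 - a -> P 1%N = X - b -> Q 0%N = 1 - a -> Q 1%N = Y - b ->
  (forall l, P l.+2 + P l = X * P l.+1) ->
  (forall l, Q l.+2 + Q l = Y * Q l.+1) ->
  X * P M = b' * P M + (1 - a') * P M.-1 ->
  Y * Q M = b' * Q M + (1 - a') * Q M.-1 ->
  X != Y ->
  \sum_(l < M.+1) boundary_weight a a' M l * (P l * Q l) = 0.
Proof.
move=> M0 a0 a0' P0 P1 Q0 Q1 recP recQ endP endQ XY.
(* The weight at 0 absorbs the boundary term P_0 Q_{-1} - P_{-1} Q_0. *)
have partial k : (X - Y) * ((1 - a)^-1 * (P 0%N * Q 0%N) + \sum_(1 <= l < k.+1) P l * Q l)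
    = P k.+1 * Q k - P k * Q k.+1.
  elim: k => [|k IH]; first by rewrite big_geq // P0 P1 Q0 Q1; field.
  rewrite big_nat_recr //= addrA mulrDr IH.
  have -> : P k.+2 = X * P k.+1 - P k by rewrite -recP addrK.
  have -> : Q k.+2 = Y * Q k.+1 - Q k by rewrite -recQ addrK.
  by ring.
have {}XY : X - Y != 0 by rewrite subr_eq0.
apply: (mulfI XY); rewrite mulr0 (sum_boundary_weight _ _ (fun l => P l * Q l)) //.
case: M M0 endP endQ => // M _ /= endP endQ.
rewrite mulrDr partial.
(* After [endP] and [endQ] the b' terms cancel and the weight at M is absorbed, leaving the opposite
   of the Casoratian in [partial]. *)
have -> : (X - Y) * ((1 - a')^-1 * (P M.+1 * Q M.+1))
  = (1 - a')^-1 * ((X * P M.+1) * Q M.+1 - P M.+1 * (Y * Q M.+1)) by ring.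
by rewrite endP endQ; field.
Qed.

(** The cross terms are constant, 2 c c' each; the squares form geometric series of ratios z^2 and
    z^-2. *)
Lemma sum_sqr_wave (c c' z : K) (N : nat) : z != 0 -> z ^+ 2 != 1 ->
  \sum_(l < N) (c * z ^+ l + c' / z ^+ l) ^+ 2
  = 2 * N%:R * c * c' + (c ^+ 2 * ((z ^+ N) ^+ 2 - 1)
      + c' ^+ 2 * z ^+ 2 * (1 - (z ^+ N) ^- 2)) / (z ^+ 2 - 1).
Proof.
move=> z0 z1; have {}z1 : z ^+ 2 - 1 != 0 by rewrite subr_eq0.
elim: N => [|N IH].
  by rewrite big_ord0 mulr0 !mul0r !expr0 expr1n invr1 subrr !mulr0 addr0 mul0r addr0.
rewrite big_ord_recr /= IH -[N.+1%:R]natr1 [z ^+ N.+1]exprS.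
have := expf_neq0 N z0; move: (z ^+ N) => t t0.
by field; rewrite z0 z1 t0.
Qed.

(* The share of one end, with reflection coefficient r, in the sum of squares
   divided by c c'. For the left end r = - c / c'; for the right end z^{2M} is
   eliminated through the quantization condition z^{2M} r r' = 1. *)
Definition wave_norm (z r a : K) : K :=
  1 + (r - z ^+ 2 / r) / (z ^+ 2 - 1) + a / (1 - a) * (2 - r - r^-1).

(** The weights add a / (1 - a) times the square at each end to the plain sum. With r = - c / c' the
    square at 0 is c c' (2 - r - 1/r), and quantization gives the same expression in r' at M. *)
Lemma sum_sqr_quantized (a a' c c' z r' : K) (M : nat) :
  (0 < M)%N -> 1 - a != 0 -> 1 - a' != 0 ->
  z != 0 -> z ^+ 2 != 1 -> c != 0 -> c' != 0 -> r' != 0 ->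
  z ^+ M ^+ 2 * (- c / c') * r' = 1 ->
  \sum_(l < M.+1) boundary_weight a a' M l * (c * z ^+ l + c' / z ^+ l) ^+ 2
  = c * c' * (2 * M%:R + wave_norm z (- c / c') a + wave_norm z r' a').
Proof.
move=> M0 a0 a0' z0 z1 c0 c0' r0 quant.
have z2 : z ^+ 2 - 1 != 0 by rewrite subr_eq0.
rewrite (sum_boundary_weight _ _ (fun l => (c * z ^+ l + c' / z ^+ l) ^+ 2)) //.
pose F l := (c * z ^+ l + c' / z ^+ l) ^+ 2.
have -> : \sum_(1 <= l < M) F l
    = \sum_(l < M.+1) F l - F 0%N - F M.
  rewrite -(big_mkord xpredT F) big_nat_recr //= (big_ltn M0); ring.
rewrite sum_sqr_wave // /F expr0 [z ^+ M.+1]exprS -[M.+1%:R]natr1.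
have := expf_neq0 M z0; move: quant; move: (z ^+ M) => t quant t0.
(* Solving the quantization condition for r' leaves a rational identity in free variables. *)
have -> : r' = - c' / (c * t ^+ 2).
  have d0 : t ^+ 2 * (- c / c') != 0.
    by rewrite !mulf_neq0 ?expf_neq0 ?oppr_eq0 ?invr_eq0.
  by apply: (mulfI d0); rewrite quant; field; rewrite c0 t0.
rewrite /wave_norm; field.
by rewrite t0 c0 oppr_eq0 c0' a0' z2 oppr_eq0 c0 a0 oner_eq0 z0.
Qed.

(** For z on the unit circle and real p, q the right side is v_p' + v_q'. *)
Lemma wave_norm_poisson (p q z : K) : z != 0 -> z ^+ 2 != 1 -> 1 - p * q != 0 ->
  1 - p * z != 0 -> 1 - q * z != 0 -> z - p != 0 -> z - q != 0 ->
  wave_norm z ((z - p) * (z - q) / ((1 - p * z) * (1 - q * z))) (p * q)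
  = (1 - p ^+ 2) / ((1 - p / z) * (1 - p * z))
    + (1 - q ^+ 2) / ((1 - q / z) * (1 - q * z)).
Proof.
move=> z0 z1 a0 p0 q0 p1 q1; rewrite /wave_norm.
have z2 : z ^+ 2 - 1 != 0 by rewrite subr_eq0.
field.
by rewrite z0 q0 q1 p0 p1 a0 z2.
Qed.

(** Here t stands for z^M and t / z for z^(M-1). The boundary condition is homogeneous in (c, c'),
    so it depends only on their ratio, which the quantization condition supplies. *)
Lemma reflection_boundary (p q c c' t z : K) : z != 0 -> t != 0 -> c' != 0 ->
  1 - p * z != 0 -> 1 - q * z != 0 -> z - p != 0 -> z - q != 0 ->
  t ^+ 2 * (- c / c') * ((z - p) * (z - q) / ((1 - p * z) * (1 - q * z))) = 1 ->
  (z + z^-1) * (c * t + c' / t) = (p + q) * (c * t + c' / t)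
    + (1 - p * q) * (c * (t / z) + c' / (t / z)).
Proof.
move=> z0 t0 c0 p0 q0 p1 q1 quant.
have -> : c = - c' * ((1 - p * z) * (1 - q * z)) / ((z - p) * (z - q)) / t ^+ 2.
  have d0 : t ^+ 2 * (- c'^-1) * ((z - p) * (z - q) / ((1 - p * z) * (1 - q * z))) != 0.
    by rewrite !mulf_neq0 ?expf_neq0 ?oppr_eq0 ?invr_eq0 // mulf_neq0.
  apply: (mulIf d0); transitivity (1 : K).
    by rewrite -[RHS]quant; field; rewrite p0 q0 c0.
  by field; rewrite p0 q0 p1 q1 c0 t0.
by field; rewrite z0 t0 p1 q1.
Qed.
End DiscreteOrthogonality.

(** * The phase functions and the Bethe equation *)

Section Phase.
Local Open Scope classical_set_scope.
Variables (R : realType) (q : R).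
Hypotheses (q_gtN1 : -1 < q) (q_lt1 : q < 1).

(** The expression equals (1 - q)^2 + 2 q (1 - cos x) and also (1 + q)^2 - 2 q (1 + cos x); the sign
    of q selects the useful form. *)
Lemma poisson_denom_gt0 (x : R) : 0 < 1 - 2 * q * cos x + q ^+ 2.
Proof.
move: q_gtN1 q_lt1 (cos_geN1 x) (cos_le1 x) => q1 q2 c1 c2.
have [q0|q0] := leP 0 q.
  have : 0 <= q * (1 - cos x) by apply: mulr_ge0; lra.
  have : 0 < (1 - q) ^+ 2 by apply: exprn_gt0; lra.
  nra.
have : 0 <= - q * (1 + cos x) by apply: mulr_ge0; lra.
have : 0 < (1 + q) ^+ 2 by apply: exprn_gt0; lra.
nra.
Qed.

Lemma subr1_mul_cos_gt0 (x : R) : 0 < 1 - q * cos x.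
Proof.
move: q_gtN1 q_lt1 (cos_geN1 x) (cos_le1 x) => q1 q2 c1 c2.
have [q0|q0] := leP 0 q.
  have : 0 <= q * (1 - cos x) by apply: mulr_ge0; lra.
  lra.
have : 0 <= - q * (1 + cos x) by apply: mulr_ge0; lra.
lra.
Qed.

Lemma one_sub_expi_mul (x : R) :
  (1 - q%:C * expi (- x)) * (1 - q%:C * expi x)
    = (1 - 2 * q * cos x + q ^+ 2)%:C.
Proof.
rewrite /expi cosN sinN; apply/eqP; rewrite eq_complex /=.
have s2 := sin2cos2 x.
apply/andP; split; apply/eqP; last by ring.
rewrite !mul0r !subr0 !add0r !addr0 !mulrN !mulNr !opprK.
have -> : 1 - 2 * q * cos x + q ^+ 2
  = 1 - 2 * q * cos x + q ^+ 2 * (cos x ^+ 2 + sin x ^+ 2).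
  by rewrite s2; ring.
ring.
Qed.

Lemma one_sub_expi_neq0 (x : R) : 1 - q%:C * expi x != 0.
Proof.
have : (1 - q%:C * expi (- x)) * (1 - q%:C * expi x) != 0.
  by rewrite one_sub_expi_mul fmorph_eq0 gt_eqF ?poisson_denom_gt0.
by rewrite mulf_eq0 negb_or => /andP[].
Qed.

Let f (x : R) := (1 - q ^+ 2) / (1 - 2 * q * cos x + q ^+ 2).
(** [atan (t x)] is minus the argument of 1 - q e^{ix}, a branch smooth on the whole line since 1 -
    q cos x stays positive. *)
Let t (x : R) := q * sin x / (1 - q * cos x).
Let F (x : R) := x + 2 * atan (t x).

Let t_derive (x : R) : is_derive x 1 t
  ((q * cos x * (1 - q * cos x) - q * sin x * (q * sin x)) / (1 - q * cos x) ^+ 2).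
Proof.
have d0 : 1 - q * cos x != 0 by rewrite gt_eqF ?subr1_mul_cos_gt0.
have dn : is_derive x 1 (fun y => q * sin y) (q * cos x) by exact: is_deriveZ.
have dd : is_derive x 1 (fun y => 1 - q * cos y) (q * sin x).
  have d1 : is_derive x 1 (fun y => q * cos y) (q * - sin x).
    exact: is_deriveZ.
  have := is_deriveB (is_derive_cst (1 : R) x 1) d1.
  by rewrite sub0r mulrN opprK.
have dt : is_derive x 1 t _ :=
  is_deriveM dn (is_deriveV (f := fun y => 1 - q * cos y) d0 dd).
apply: (is_derive_eq dt); rewrite /GRing.scale /=.
by field.
Qed.

Let one_add_sqr_t (x : R) :
  1 + t x ^+ 2 = (1 - 2 * q * cos x + q ^+ 2) / (1 - q * cos x) ^+ 2.
Proof.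
have d0 : 1 - q * cos x != 0 by rewrite gt_eqF ?subr1_mul_cos_gt0.
rewrite /t expr_div_n exprMn sin2cos2.
by field.
Qed.

Let F_derive (x : R) : is_derive x 1 F (f x).
Proof.
have d0 : 1 - q * cos x != 0 by rewrite gt_eqF ?subr1_mul_cos_gt0.
have p0 : 1 - 2 * q * cos x + q ^+ 2 != 0 by rewrite gt_eqF ?poisson_denom_gt0.
have dat : is_derive x 1 (atan \o t) _ :=
  is_derive1_comp (is_derive1_atan (t x)) (t_derive x).
have dF : is_derive x 1 F _ := is_deriveD (is_derive_id x 1) (is_deriveZ 2 dat).
apply: (is_derive_eq dF).
rewrite /f /GRing.scale /= one_add_sqr_t.
have s2 := sin2cos2 x.
have -> : q * sin x * (q * sin x) = q ^+ 2 * (1 - cos x ^+ 2) by rewrite -s2; ring.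
by field; rewrite d0 p0.
Qed.

Let F_derivable (x : R) : derivable F x 1.
Proof. by case: (F_derive x). Qed.

Let f_continuous : continuous f.
Proof.
move=> x; apply: cvgM; first exact: cvg_cst.
apply: cvgV; first by rewrite gt_eqF ?poisson_denom_gt0.
apply: cvgD; last exact: cvg_cst.
apply: cvgB; first exact: cvg_cst.
apply: cvgM; first exact: cvg_cst.
exact: continuous_cos.
Qed.

Let F0 : F 0 = 0.
Proof. by rewrite /F /t sin0 mulr0 mul0r atan0 mulr0 addr0. Qed.

Let FN x : F (- x) = - F x.
Proof. by rewrite /F /t sinN cosN mulrN mulNr atanN mulrN opprD. Qed.

Let F_continuous : continuous F.
Proof. by move=> x; apply/differentiable_continuous/derivable1_diffP. Qed.

Let FTC a b : a < b -> \int[lebesgue_measure]_(x in `[a, b]) f x = F b - F a.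
Proof.
move=> ab; rewrite /Rintegral (continuous_FTC2 (F := F) ab) //.
- exact/continuous_subspaceT.
- split=> [x _||]; first exact: F_derivable.
  + exact/cvg_at_right_filter/F_continuous.
  + exact/cvg_at_left_filter/F_continuous.
- by move=> x _; rewrite derive1E; apply: derive_val.
Qed.

(** The fundamental theorem of calculus on either side of 0, following the case split in [v]. *)
Lemma v_atan : v q = F.
Proof.
apply/funext => x; rewrite /v -/f; case: (ltgtP 0 x) => [x0|x0|<-].
- by rewrite FTC// F0 subr0.
- by rewrite FTC // F0 sub0r opprK.
- by rewrite set_itv1 Rintegral_set1 F0.
Qed.

Lemma derive1_v (x : R) : derive1 (v q) x = f x.
Proof. by rewrite v_atan derive1E; apply: derive_val. Qed.

Lemma continuous_v : continuous (v q).
Proof. by rewrite v_atan. Qed.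

Lemma v_at0 : v q 0 = 0. Proof. by rewrite v_atan. Qed.

Lemma v_pi : v q pi = pi.
Proof. by rewrite v_atan /F /t sinpi mulr0 mul0r atan0 mulr0 addr0. Qed.

Lemma v_homo : {homo v q : x y / x <= y}.
Proof.
move=> x y xy; apply: (@ger0_derive1_ndecr _ (v q) x y) => //.
- by move=> z _; rewrite v_atan; exact: F_derivable.
- move=> z _; rewrite derive1_v /f divr_ge0 ?(ltW (poisson_denom_gt0 _)) //.
  by move: q_gtN1 q_lt1; nra.
- exact/continuous_subspaceT/continuous_v.
Qed.

(** Doubling the argument gives e^{2 i atan t} = (1 - q e^{-ix}) / (1 - q e^{ix}); the factor e^{ix}
    does the rest. *)
Lemma expi_v (x : R) : expi (v q x) = (expi x - q%:C) / (1 - q%:C * expi x).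
Proof.
have d0 : 1 - q * cos x != 0 by rewrite gt_eqF ?subr1_mul_cos_gt0.
have p0 : 1 - 2 * q * cos x + q ^+ 2 != 0 by rewrite gt_eqF ?poisson_denom_gt0.
have z0 := expi_neq0 x.
(* This is 1 - q e^{-ix} rescaled to modulus 1. *)
have atanE : expi (atan (t x))
    = (cos (atan (t x)) / (1 - q * cos x))%:C * (1 - q%:C * expi (- x)).
  have cos0 : cos (atan (t x)) != 0.
    by rewrite gt_eqF // cos_gt0_pihalf // atan_gtNpi2 atan_ltpi2.
  have sE : sin (atan (t x)) = cos (atan (t x)) * t x.
    by rewrite -{3}(atanK (t x)) /tan mulrC divfK.
  rewrite {1}/expi sE /expi cosN sinN /t; apply/eqP; rewrite eq_complex /=.
  by apply/andP; split; apply/eqP; field.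
(* Squaring removes the square root in [cos_atan]. *)
have sqr_atanE : expi (2 * atan (t x))
    = (1 - q%:C * expi (- x)) ^+ 2 / (1 - 2 * q * cos x + q ^+ 2)%:C.
  rewrite mulr_natl mulr2n expiD -expr2 atanE exprMn mulrC -rmorphXn.
  congr (_ * _); rewrite -fmorphV; congr (_%:C).
  rewrite expr_div_n cos_atan exprVn sqr_sqrtr ?addr_ge0 ?ler01 ?sqr_ge0 //.
  by rewrite one_add_sqr_t; field; rewrite d0 p0.
have dP0 := one_sub_expi_neq0 x.
have dN0 := one_sub_expi_neq0 (- x).
rewrite v_atan expiD sqr_atanE -one_sub_expi_mul; move: dN0; rewrite expiN => dN0.
have zq0 : expi x - q%:C != 0.
  have -> : expi x - q%:C = expi x * (1 - q%:C / expi x) by field.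
  by rewrite mulf_neq0.
by field; rewrite z0 dP0.
Qed.

Lemma derive1_v_expi (x : R) : (derive1 (v q) x)%:C
  = (1 - q%:C ^+ 2) / ((1 - q%:C * expi (- x)) * (1 - q%:C * expi x)).
Proof.
by rewrite derive1_v one_sub_expi_mul /f fmorph_div rmorphB rmorphXn rmorph1.
Qed.

End Phase.

(** * Existence and location of the nodes, and their Bethe equation *)

Section Nodes.
Local Open Scope classical_set_scope.
Variable R : realType.

Lemma expi2pi (k : nat) : expi (2 * pi * k%:R : R) = 1.
Proof.
elim: k => [|k IH]; first by rewrite mulr0 /expi cos0 sin0.
rewrite -[k.+1%:R]natr1 mulrDr mulr1 expiD IH mul1r /expi mulr_natl.
by rewrite cos2pi sin2pi.
Qed.

Lemma expiMn (x : R) (k : nat) : expi (k%:R * x) = expi x ^+ k.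
Proof.
elim: k => [|k IH]; first by rewrite mul0r /expi cos0 sin0.
by rewrite -[k.+1%:R]natr1 mulrDl mul1r expiD IH exprSr.
Qed.

Lemma cos_expi (x : R) : (2 * cos x)%:C = expi x + (expi x)^-1.
Proof.
rewrite -expiN /expi cosN sinN; apply/eqP; rewrite eq_complex /=.
by apply/andP; split; apply/eqP; ring.
Qed.

Lemma expi_sqr_neq1 (x : R) : sin x != 0 -> expi x ^+ 2 != 1.
Proof.
move=> s0; have z0 := expi_neq0 x; apply/eqP => z1.
have := sin_expi x; rewrite (_ : _ - _ = (expi x ^+ 2 - 1) / expi x); last first.
  by field.
rewrite z1 subrr mul0r => /eqP; rewrite !mulf_eq0 pnatr_eq0 /= !fmorph_eq0.
by rewrite (negPf s0) orbF eq_complex /= oner_eq0 andbF.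
Qed.

Variables pm qm pp qp : R.
Hypotheses (hpm : -1 < pm) (hpm1 : pm < 1) (hqm : -1 < qm) (hqm1 : qm < 1).
Hypotheses (hpp : -1 < pp) (hpp1 : pp < 1) (hqp : -1 < qp) (hqp1 : qp < 1).

Let phase (M : nat) (xi : R) : R :=
  2 * M%:R * xi + v pm xi + v qm xi + v pp xi + v qp xi.

Let phase_homo M : {homo phase M : x y / x <= y}.
Proof.
move=> x y xy; rewrite /phase !lerD ?v_homo //.
by rewrite ler_wpM2l // mulr_ge0.
Qed.

Let phase0 M : phase M 0 = 0.
Proof. by rewrite /phase !v_at0 // mulr0 !addr0. Qed.

(** Each of the four v terms contributes pi, so the levels 2 pi (l + 1) with l <= M lie strictly
    between the values at 0 and pi. *)
Let phasepi M : phase M pi = 2 * pi * M.+2%:R.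
Proof. rewrite /phase !v_pi // -[M.+2%:R]natr1 -[M.+1%:R]natr1; ring. Qed.

Variables (M l : nat).
Hypothesis lM : (l <= M)%N.
Let x := node pm qm pp qp M l.

Lemma node_phase : phase M x = 2 * pi * l.+1%:R.
Proof.
(* The intermediate value theorem on [0, pi] rules out the default value of [xget]. *)
rewrite /x /node; case: xgetP => [y _ yE|nosol]; first exact: yE.
have [|||y _ yE] := @IVT R (phase M) 0 pi (2 * pi * l.+1%:R).
- exact: pi_ge0.
- apply: continuous_subspaceT => y; rewrite /phase.
  do 4 (apply: cvgD; last exact: continuous_v).
  by apply: cvgM; [exact: cvg_cst|exact: cvg_id].
- rewrite phase0 phasepi; have p0 := pi_gt0 R.
  rewrite min_l ?max_r ?mulr_ge0 ?(ltW p0) //=.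
  by rewrite ler_pM2l ?mulr_gt0 // ler_nat ltnW.
by case: (nosol y); exact: yE.
Qed.

Lemma node_itv : 0 < x < pi.
Proof.
have p0 := pi_gt0 R; have xE := node_phase.
apply/andP; split; rewrite ltNge; apply/negP => /(phase_homo M).
  by rewrite xE phase0 leNgt !mulr_gt0 // ltr0Sn.
by rewrite xE phasepi ler_pM2l ?mulr_gt0 // ler_nat ltnNge ltnS lM.
Qed.

Lemma sin_node_neq0 : sin x != 0.
Proof. by rewrite gt_eqF // sin_gt0_pi // node_itv. Qed.

(* By [expi_v], this is e^{i (v_p + v_q)} in terms of z = e^{i xi}. *)
Definition reflection (p q : R) (z : R[i]) : R[i] :=
  (z - p%:C) * (z - q%:C) / ((1 - p%:C * z) * (1 - q%:C * z)).

Lemma node_bethe :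
  expi x ^+ M ^+ 2 * reflection pm qm (expi x) * reflection pp qp (expi x) = 1.
Proof.
rewrite -(expi2pi l.+1) -node_phase /phase !expiD !expi_v // /reflection.
rewrite -natrM expiMn mulnC exprM.
by field; rewrite !one_sub_expi_neq0.
Qed.

End Nodes.

(** * Bernstein-Szegő polynomials as waves with reflecting ends *)

Section Wave.
Variables (R : realType) (p q x : R).
Hypotheses (hp : -1 < p) (hp1 : p < 1) (hq : -1 < q) (hq1 : q < 1).
Hypothesis sx : sin x != 0.
Let z := expi x.

Let z0 : z != 0. Proof. exact: expi_neq0. Qed.
Let z1 : z ^+ 2 != 1. Proof. exact: expi_sqr_neq1. Qed.

Let p0 : 1 - p%:C * z != 0. Proof. exact: one_sub_expi_neq0. Qed.
Let q0 : 1 - q%:C * z != 0. Proof. exact: one_sub_expi_neq0. Qed.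
Let sub_expi_neq0 (r : R) : -1 < r -> r < 1 -> z - r%:C != 0.
Proof.
move=> r1 r2; have := one_sub_expi_neq0 r1 r2 (- x); rewrite expiN -/z => h.
by have -> : z - r%:C = z * (1 - r%:C / z); [field|rewrite mulf_neq0].
Qed.
Let zp0 : z - p%:C != 0. Proof. exact: sub_expi_neq0. Qed.
Let zq0 : z - q%:C != 0. Proof. exact: sub_expi_neq0. Qed.
Let z2 : z ^+ 2 - 1 != 0. Proof. by rewrite subr_eq0. Qed.
Let z2' : 1 - z ^+ 2 != 0. Proof. by rewrite subr_eq0 eq_sym. Qed.

Lemma cfunE : cfun p q x = (z - p%:C) * (z - q%:C) / (z ^+ 2 - 1).
Proof.
by rewrite /cfun mulNr !expiN expiMn -/z; field; rewrite z0 z2.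
Qed.

Lemma cfunNE : cfun p q (- x) = (1 - p%:C * z) * (1 - q%:C * z) / (1 - z ^+ 2).
Proof. by rewrite /cfun opprK mulrNN expiMn. Qed.

Lemma cfun_neq0 : cfun p q x != 0.
Proof. by rewrite cfunE !mulf_neq0 // invr_eq0. Qed.

Lemma cfunN_neq0 : cfun p q (- x) != 0.
Proof. by rewrite cfunNE !mulf_neq0 // invr_eq0. Qed.

(** Identifies the phase factor e^{i (v_p + v_q)} with the reflection coefficient of the wave at the
    left end. *)
Lemma cfun_ratio : - cfun p q x / cfun p q (- x) = reflection p q z.
Proof. by rewrite cfunE cfunNE /reflection; field; rewrite z2 z2' p0 q0. Qed.

Lemma reflection_neq0 : reflection p q z != 0.
Proof. by rewrite -cfun_ratio !mulf_neq0 ?oppr_eq0 ?invr_eq0 ?cfun_neq0 ?cfunN_neq0. Qed.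

Lemma reflection_wave_norm : 1 - p%:C * q%:C != 0 ->
  wave_norm z (reflection p q z) (p%:C * q%:C)
  = (derive1 (v p) x + derive1 (v q) x)%:C.
Proof.
move=> pq1; rewrite wave_norm_poisson // -expiN.
by rewrite -(derive1_v_expi hp hp1) -(derive1_v_expi hq hq1) -rmorphD.
Qed.

Lemma bernstein_szego_nat (l : nat) :
  bernstein_szego p q l%:Z x = cfun p q x * z ^+ l + cfun p q (- x) / z ^+ l.
Proof. by rewrite /bernstein_szego mulNr expiN -pmulrn expiMn. Qed.

(** This value and the next one encode the left boundary condition of [christoffel_darboux]. *)
Lemma bernstein_szego0 : bernstein_szego p q 0 x = 1 - p%:C * q%:C.
Proof.
by rewrite (bernstein_szego_nat 0) cfunE cfunNE expr0; field; rewrite z2 z2'.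
Qed.

Lemma bernstein_szego1 : bernstein_szego p q 1 x = z + z^-1 - (p%:C + q%:C).
Proof.
by rewrite (bernstein_szego_nat 1) cfunE cfunNE expr1; field; rewrite z2 z2' z0.
Qed.

Lemma bernstein_szego_rec (l : nat) :
  bernstein_szego p q l.+2%:Z x + bernstein_szego p q l%:Z x
  = (z + z^-1) * bernstein_szego p q l.+1%:Z x.
Proof.
rewrite !bernstein_szego_nat !exprS; have := expf_neq0 l z0.
by move: (z ^+ l) => t t0; field; rewrite z0 t0.
Qed.

Variables (p' q' : R) (M : nat).
Hypotheses (hp' : -1 < p') (hp1' : p' < 1) (hq' : -1 < q') (hq1' : q' < 1).
Hypothesis M0 : (0 < M)%N.
Hypothesis quant : z ^+ M ^+ 2 * reflection p q z * reflection p' q' z = 1.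

Lemma bernstein_szego_boundary :
  (z + z^-1) * bernstein_szego p q M%:Z x
  = (p'%:C + q'%:C) * bernstein_szego p q M%:Z x
    + (1 - p'%:C * q'%:C) * bernstein_szego p q M.-1%:Z x.
Proof.
have zM : z ^+ M.-1 = z ^+ M / z by rewrite -[in RHS](prednK M0) exprS mulrC mulKf.
rewrite !bernstein_szego_nat zM; apply: reflection_boundary => //.
- exact: expf_neq0.
- exact: cfunN_neq0.
- exact: one_sub_expi_neq0.
- exact: one_sub_expi_neq0.
- exact: sub_expi_neq0.
- exact: sub_expi_neq0.
- by rewrite cfun_ratio.
Qed.

End Wave.

(** * Orthogonality in one variable *)

Section NodeOrthogonality.
Variables (R : realType) (pm qm pp qp : R).
Hypotheses (hpm : -1 < pm) (hpm1 : pm < 1) (hqm : -1 < qm) (hqm1 : qm < 1).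
Hypotheses (hpp : -1 < pp) (hpp1 : pp < 1) (hqp : -1 < qp) (hqp1 : qp < 1).
Variables (M : nat).
Hypothesis M0 : (0 < M)%N.
Let x := node pm qm pp qp M.

Lemma one_sub_mul_neq0 (p q : R) : -1 < p -> p < 1 -> -1 < q -> q < 1 ->
  1 - p%:C * q%:C != 0.
Proof.
move=> p1 p2 q1 q2; rewrite -rmorphM -[1](rmorph1 (real_complex R)) -rmorphB.
rewrite fmorph_eq0 subr_eq0 eq_sym; apply/eqP => pq.
have : `|p * q| < 1 by rewrite normrM mulr_ilt1 // ltr_norml; apply/andP.
by rewrite pq normr1 ltxx.
Qed.

(** Cosine is injective on [0, pi], and a node determines its level through the phase equation. This
    separates the spectral parameters 2 cos(xi). *)
Lemma node_cos_inj (l l' : nat) : (l <= M)%N -> (l' <= M)%N ->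
  cos (x l) = cos (x l') -> l = l'.
Proof.
move=> lM lM' cosE.
have xE : x l = x l'.
  have /andP[? ?] := node_itv hpm hpm1 hqm hqm1 hpp hpp1 hqp hqp1 lM.
  have /andP[? ?] := node_itv hpm hpm1 hqm hqm1 hpp hpp1 hqp hqp1 lM'.
  by apply: cos_inj => //; rewrite in_itv /= !ltW.
have := node_phase hpm hpm1 hqm hqm1 hpp hpp1 hqp hqp1 lM.
rewrite -/x xE node_phase // => /mulfI h.
have /h/eqP : 2 * pi != 0 :> R by rewrite mulf_neq0 ?pnatr_eq0 // gt_eqF // pi_gt0.
by rewrite eqr_nat eqSS => /eqP ->.
Qed.

Lemma node_orthogonality (l l' : nat) : (l <= M)%N -> (l' <= M)%N ->
  \sum_(k < M.+1) boundary_weight (pm%:C * qm%:C) (pp%:C * qp%:C) M k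
    * (bernstein_szego pm qm k%:Z (x l) * bernstein_szego pm qm k%:Z (x l'))
  = if l == l' then
      cfun pm qm (x l) * cfun pm qm (- x l) * (H1 pm qm pp qp M (x l))%:C
    else 0.
Proof.
move=> lM lM'.
have sl : sin (x l) != 0 by exact: sin_node_neq0.
have sl' : sin (x l') != 0 by exact: sin_node_neq0.
case: eqVneq => [<-|ll'].
  under eq_bigr do rewrite !bernstein_szego_nat // -expr2.
  rewrite (@sum_sqr_quantized _ _ _ _ _ _ (reflection pp qp (expi (x l)))) //.
  (* Each end contributes two Poisson kernels; with 2 M they make up [H1]. *)
  - rewrite cfun_ratio // !reflection_wave_norm ?one_sub_mul_neq0 //.
    rewrite /H1; move: (derive1 (v pm) _) (derive1 (v qm) _) => u1 u2.
    move: (derive1 (v pp) _) (derive1 (v qp) _) => u3 u4.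
    by rewrite !rmorphD /= rmorphM /= !rmorph_nat !addrA.
  - exact: one_sub_mul_neq0.
  - exact: one_sub_mul_neq0.
  - exact: expi_neq0.
  - exact: expi_sqr_neq1.
  - exact: cfun_neq0.
  - exact: cfunN_neq0.
  - exact: reflection_neq0.
  - by rewrite cfun_ratio // node_bethe.
apply: (@christoffel_darboux _ _ _ (pm%:C + qm%:C) (pp%:C + qp%:C)
  (expi (x l) + (expi (x l))^-1) (expi (x l') + (expi (x l'))^-1)
  (fun k => bernstein_szego pm qm k%:Z (x l))
  (fun k => bernstein_szego pm qm k%:Z (x l'))).
- exact: M0.
- exact: one_sub_mul_neq0.
- exact: one_sub_mul_neq0.
- exact: bernstein_szego0.
- exact: bernstein_szego1.
- exact: bernstein_szego0.
- exact: bernstein_szego1.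
- by move=> k; exact: bernstein_szego_rec.
- by move=> k; exact: bernstein_szego_rec.
- by apply: bernstein_szego_boundary => //; exact: node_bethe.
- by apply: bernstein_szego_boundary => //; exact: node_bethe.
rewrite -!cos_expi; apply: contra_neq ll' => /(fmorph_inj (real_complex R)) /mulfI.
by rewrite pnatr_eq0 => /(_ isT); apply: node_cos_inj.
Qed.

End NodeOrthogonality.

(** * Reduction to one variable *)

Section Staircase.
Variables m n : nat.
Let M := (m + n - 1)%N.

Lemma LambdaP (lam : n.-tuple 'I_m.+1) :
  reflect (forall i j : 'I_n, (i < j)%N -> (tnth lam j <= tnth lam i)%N)
    (lam \in Lambda m n).
Proof.
have geqT : transitive geq by move=> y x z /= yx zy; exact: leq_trans yx.
rewrite inE sorted_pairwise //.
have nthE (i : 'I_n) : nth 0%N [seq val x | x <- lam] i = tnth lam i.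
  by rewrite (nth_map ord0) ?size_tuple // -tnth_nth.
apply: (iffP (pairwiseP 0%N)) => [pw i j ij|pw i j].
  by have := pw i j; rewrite !inE size_map size_tuple !nthE; apply.
rewrite !inE size_map size_tuple => ni nj ij.
by have := pw (Ordinal ni) (Ordinal nj) ij; rewrite -!nthE.
Qed.

Lemma stair_bound (k j : nat) :
  (j < n)%N -> (k <= m)%N -> (k + (n - j.+1) <= M)%N.
Proof. rewrite /M; lia. Qed.

(** Adding (n-1, ..., 0) turns weakly decreasing tuples into strictly decreasing ones; by
    [stair_bound] the default value of [inord] never occurs. *)
Definition staircase (lam : n.-tuple 'I_m.+1) : {ffun 'I_n -> 'I_M.+1} :=
  [ffun j : 'I_n => inord (tnth lam j + (n - j.+1))].

Lemma staircaseE (lam : n.-tuple 'I_m.+1) (j : 'I_n) :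
  staircase lam j = (tnth lam j + (n - j.+1))%N :> nat.
Proof.
by rewrite ffunE inordK // ltnS stair_bound // -ltnS.
Qed.

Lemma staircase_inj : injective staircase.
Proof.
move=> lam mu /ffunP eq; apply/eq_from_tnth => j; apply/val_inj.
by have := congr1 val (eq j); rewrite /= !staircaseE => /addIn.
Qed.

Lemma staircase_decreasing (lam : n.-tuple 'I_m.+1) :
  lam \in Lambda m n -> decreasing_ffun (staircase lam).
Proof.
move/LambdaP => lamL; apply/'forall_forallP => i j; apply/implyP => ij.
rewrite !staircaseE.
have := lamL _ _ ij; have := ltn_ord j; lia.
Qed.

(** A strictly decreasing sequence of integers drops by at least 1 at each step. *)
Lemma decreasing_ffun_gap N (g : {ffun 'I_n -> 'I_N}) (i j : 'I_n) :
  decreasing_ffun g -> (i <= j)%N -> (g j + (j - i) <= g i)%N.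
Proof.
move=> /'forall_forallP dec.
move kE: (nat_of_ord j) => k; elim: k j kE => [|k IH] j jE ij.
  have -> : i = j by apply/val_inj => /=; lia.
  by lia.
have [->|ij'] := eqVneq i j; first by lia.
have kn : (k < n)%N by have := ltn_ord j; lia.
have {ij'}ltij : (i < j)%N by rewrite ltn_neqAle ij' jE.
have := IH (Ordinal kn) erefl ltac:(lia).
have := elimT implyP (dec (Ordinal kn) j) ltac:(rewrite /=; lia).
lia.
Qed.

Lemma staircase_image :
  staircase @: Lambda m n = [set g | decreasing_ffun g].
Proof.
apply/setP => g; rewrite inE; apply/imsetP/idP => [[lam lamL ->]|dec].
  exact: staircase_decreasing.
have gap i j := @decreasing_ffun_gap _ g i j dec.
(* Comparison with the last index: subtracting the staircase never truncates. *)
have lo (j : 'I_n) : (n - j.+1 <= g j)%N.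
  have nn : (n.-1 < n)%N by have := ltn_ord j; lia.
  have jnn : (j <= n.-1)%N by have := ltn_ord j; lia.
  have := gap j (Ordinal nn) jnn; rewrite /=; have := ltn_ord j; lia.
(* Comparison with the first index, where the value is at most m + n - 1. *)
have hi (j : 'I_n) : (g j - (n - j.+1) < m.+1)%N.
  have nn : (0 < n)%N by have := ltn_ord j; lia.
  have := gap (Ordinal nn) j (leq0n j); rewrite /=; have := ltn_ord j.
  have := ltn_ord (g (Ordinal nn)); have : M = (m + n - 1)%N by [].
  move: (g _) (g _) => u w; lia.
exists [tuple Ordinal (hi j) | j < n].
  apply/LambdaP => i j ij; rewrite !tnth_mktuple /=.
  have := gap i j (ltnW ij); have := ltn_ord j; lia.
by apply/ffunP => j; apply/val_inj; rewrite /= staircaseE tnth_mktuple /= subnK.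
Qed.

End Staircase.

(** * Factorization of the weights *)

Section Weights.
Variables (R : realType) (pm qm pp qp : R) (m n : nat).
Hypotheses (m0 : (0 < m)%N) (n0 : (0 < n)%N).
Let M := (m + n - 1)%N.

(** An index lam_j + n - j can be 0 only for j = n with lam_n = 0, and m + n - 1 only for j = 1 with
    lam_1 = m, so at most one factor feels each end. *)
Lemma prod_boundary_weight (lam : n.-tuple 'I_m.+1) :
  \prod_(j < n) boundary_weight (pm%:C * qm%:C) (pp%:C * qp%:C) M (staircase lam j)
  = (Delta pm qm pp qp lam)%:C.
Proof.
have nE := prednK n0.
have nmax : (n.-1 < n)%N by rewrite nE.
have tnthE (j : 'I_n) : nth ord0 lam j = tnth lam j by rewrite (tnth_nth ord0).
have weightC (p q : R) (b : bool) :
    ((1 - p * q * b%:R)^-1)%:C = (1 - p%:C * q%:C * b%:R)^-1.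
  by rewrite fmorphV rmorphB rmorph1 !rmorphM rmorph_nat.
rewrite /Delta big_split /= rmorphM /= /delta !weightC.
congr (_ * _).
- rewrite (bigD1 (Ordinal nmax)) //= big1 ?mulr1 => [|j /eqP jmax].
    rewrite staircaseE /= nE subnn addn0 -tnthE.
    by congr (1 - _ * (_ : bool)%:R)^-1.
  rewrite staircaseE (_ : (_ == _) = false) ?mulr0 ?subr0 ?invr1 //.
  apply/eqP => h; apply: jmax; apply/val_inj => /=; have := ltn_ord j; lia.
- rewrite (bigD1 (Ordinal n0)) //= big1 ?mulr1 => [|j /eqP jmin].
    rewrite staircaseE /= -tnthE /=; congr (1 - _ * (_ : bool)%:R)^-1.
    have := ltn_ord (nth ord0 lam 0); rewrite /M; lia.
  rewrite staircaseE (_ : (_ == _) = false) ?mulr0 ?subr0 ?invr1 //.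
  apply/eqP => h; apply: jmin; apply/val_inj => /=.
  have := ltn_ord j; have := ltn_ord (tnth lam j); move: h; rewrite /M; lia.
Qed.

End Weights.

(** * The product C(xi) C(-xi) *)

Section ProductFormula.
Variables (R : realType) (pm qm : R) (n : nat).

(** Since (1 - e^{i(x+y)}) (1 - e^{i(x-y)}) = 2 e^{ix} (cos x - cos y), multiplying by the conjugate
    cancels the phase. *)
Lemma expi_diff_norm (x y : R) :
  (1 - expi (- (x + y))) * (1 - expi (- (x - y)))
    * ((1 - expi (x + y)) * (1 - expi (x - y)))
  = ((2 * (cos x - cos y)) ^+ 2)%:C.
Proof.
rewrite [2 * (_ - _)]mulrBr rmorphXn rmorphB /= !cos_expi !opprD !opprK !expiD !expiN.
by have := expi_neq0 x; have := expi_neq0 y => y0 x0; field; rewrite y0 x0.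
Qed.

Lemma C_mul_CN (xi : 'rV[R]_n) :
  C pm qm xi * C pm qm (- xi)
  = (\prod_(j < n) (cfun pm qm (xi 0 j) * cfun pm qm (- xi 0 j)))
    / (V xi ^+ 2)%:C.
Proof.
rewrite /C mulrACA; congr (_ * _).
  by rewrite -big_split; apply: eq_bigr => j _; rewrite mxE.
rewrite /V -prodrXl rmorph_prod -prodfV -big_split; apply: eq_bigr => j _.
rewrite -big_split -prodrXl rmorph_prod -prodfV; apply: eq_bigr => k _ /=.
rewrite !mxE -expi_diff_norm !opprB !opprK !invfM.
by rewrite (addrC (xi 0 k) (xi 0 j)) (addrC (- xi 0 k)).
Qed.

End ProductFormula.

(** * The sum over partitions as a determinant *)

Section MainTheorem.
Variables (R : realType) (m n : nat) (pm qm pp qp : R).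
Let M := (m + n - 1)%N.

Definition wave_mx (xi : 'rV[R]_n) : 'M[R[i]]_(M.+1, n) :=
  \matrix_(l, k) bernstein_szego pm qm (l : nat)%:Z (xi 0 k).

(** The weight sits in one factor only, so that the entries of [weighted_wave_mx xi *m wave_mx eta]
    are weighted one-variable sums. *)
Definition weighted_wave_mx (xi : 'rV[R]_n) : 'M[R[i]]_(n, M.+1) :=
  \matrix_(k, l) (bernstein_szego pm qm (l : nat)%:Z (xi 0 k)
    * boundary_weight (pm%:C * qm%:C) (pp%:C * qp%:C) M l).

Lemma gschurE (lam : n.-tuple 'I_m.+1) (xi : 'rV[R]_n) :
  gschur pm qm lam xi
  = (V xi)%:C^-1 * \det (rowsub (staircase lam) (wave_mx xi)).
Proof.
congr (_ * \det _); apply/matrixP => j k; rewrite !mxE.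
by rewrite staircaseE addnC.
Qed.

Lemma det_weighted_wave_mx (g : {ffun 'I_n -> 'I_M.+1}) (xi : 'rV[R]_n) :
  \det (colsub g (weighted_wave_mx xi))
  = \det (rowsub g (wave_mx xi))
    * \prod_(j < n) boundary_weight (pm%:C * qm%:C) (pp%:C * qp%:C) M (g j).
Proof.
pose d := \row_(j < n) boundary_weight (pm%:C * qm%:C) (pp%:C * qp%:C) M (g j).
have -> : colsub g (weighted_wave_mx xi) = (rowsub g (wave_mx xi))^T *m diag_mx d.
  by apply/matrixP => i j; rewrite mul_mx_diag !mxE.
by rewrite det_mulmx det_tr det_diag; congr (_ * _); apply: eq_bigr => j _; rewrite mxE.
Qed.

(** Cauchy-Binet read backwards: the decreasing maps are the staircases of the partitions, and the
    minors they select are the numerators of the generalized Schur polynomials. *)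
Lemma sum_gschur (xi eta : 'rV[R]_n) : (0 < m)%N -> (0 < n)%N ->
  \sum_(lam in Lambda m n)
     gschur pm qm lam xi * gschur pm qm lam eta * (Delta pm qm pp qp lam)%:C
  = (V xi)%:C^-1 * (V eta)%:C^-1 * \det (weighted_wave_mx xi *m wave_mx eta).
Proof.
move=> m0 n0; rewrite cauchy_binet.
rewrite (eq_bigl [in [set g : {ffun 'I_n -> 'I_M.+1} | decreasing_ffun g]]); last first.
  by move=> g; rewrite inE.
rewrite -staircase_image big_imset /=; last by move=> ? ? _ _; exact: staircase_inj.
rewrite big_distrr /=; apply: eq_bigr => lam _.
by rewrite !gschurE det_weighted_wave_mx prod_boundary_weight //; ring.
Qed.

End MainTheorem.

Theorem theorem3p1 (R : realType) (m n : nat) (hm : (1 <= m)%N) (hn : (1 <= n)%N)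
    (pm qm pp qp : R)
    (hpm : -1 < pm) (hpqm : pm <= qm) (hqm : qm < 1)
    (hpp : -1 < pp) (hpqp : pp <= qp) (hqp : qp < 1)
    (lamh muh : n.-tuple 'I_m.+1)
    (hlamh : lamh \in Lambda m n) (hmuh : muh \in Lambda m n) :
  \sum_(lam in Lambda m n)
     psi pm qm pp qp lamh lam * psi pm qm pp qp muh lam
       * (Delta pm qm pp qp lam)%:C%C
  = if muh == lamh then 1 / Deltah pm qm pp qp lamh else 0.
Proof.
have hpm1 : pm < 1 := le_lt_trans hpqm hqm.
have hqm1 : -1 < qm := lt_le_trans hpm hpqm.
have hpp1 : pp < 1 := le_lt_trans hpqp hqp.
have hqp1 : -1 < qp := lt_le_trans hpp hpqp.
have M0 : (0 < m + n - 1)%N by rewrite subn_gt0 (leq_add hm hn).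
pose xi := nodes pm qm pp qp lamh; pose eta := nodes pm qm pp qp muh.
(* The components of [xi] and [eta] are nodes whose levels are staircase values, so one-variable
   orthogonality gives every entry. *)
have entryE (j k : 'I_n) :
    (weighted_wave_mx m pm qm pp qp xi *m wave_mx m pm qm eta) j k
    = if staircase lamh j == staircase muh k then
        cfun pm qm (xi 0 j) * cfun pm qm (- xi 0 j)
          * (H1 pm qm pp qp (m + n - 1) (xi 0 j))%:C
      else 0.
  rewrite -(inj_eq val_inj) /= !staircaseE !mxE.
  rewrite -(node_orthogonality hpm hpm1 hqm1 hqm hpp hpp1 hqp1 hqp M0); last 2 first.
  - by apply: stair_bound => //; rewrite -ltnS.
  - by apply: stair_bound => //; rewrite -ltnS.
  by apply: eq_bigr => l _; rewrite !mxE mulrAC mulrC.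
rewrite /psi sum_gschur // -/xi -/eta; case: eqVneq => [muE|muN].
  have eta_xi : eta = xi by rewrite /eta muE.
  move: entryE; rewrite eta_xi muE => entryE.
  rewrite /Deltah -/xi div1r invrK C_mul_CN.
  (* Distinct rows carry distinct staircase values, so only the diagonal survives. *)
  have -> : weighted_wave_mx m pm qm pp qp xi *m wave_mx m pm qm xi
    = diag_mx (\row_j (cfun pm qm (xi 0 j)
          * cfun pm qm (- xi 0 j)
          * (H1 pm qm pp qp (m + n - 1) (xi 0 j))%:C)).
    apply/matrixP => j k; rewrite entryE !mxE.
    rewrite (inj_eq (decreasing_ffun_inj (staircase_decreasing hlamh))).
    by case: eqVneq => [->|]; rewrite ?mulr1n ?mulr0n.
  rewrite det_diag (eq_bigr _ (fun j _ => mxE _ _ _ _)) big_split /=.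
  rewrite rmorphXn /= -expr2 exprVn mulrCA mulrA; congr (_ * _).
  by rewrite /H rmorph_prod.
(* Distinct partitions have distinct sets of staircase values, so some value of [lamh] is missing
   from [muh]; its row is zero. *)
have [j /forallP jN|sub] :=
  pickP (fun j : 'I_n => [forall k, staircase lamh j != staircase muh k]); last first.
  case/eqP: muN; apply/staircase_inj/esym/decreasing_ffun_eq.
  - exact: staircase_decreasing.
  - exact: staircase_decreasing.
  move=> j; have /negbT/forallPn[k /negPn/eqP jk] := sub j.
  by exists k.
rewrite (expand_det_row _ j) big1 ?mulr0 // => k _.
by rewrite entryE (negPf (jN k)) mul0r.
Qed.
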